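(* Let $(x(t),\lambda(t))$, $t\ge t_0$, be a (global) trajectory of the dynamical system $$\begin{cases}\ddot{x}(t)+\dfrac{\alpha}{t}\dot{x}(t)+\nabla f(x(t))+A^\top\bigl(\lambda(t)+\theta t\dot{\lambda}(t)\bigr)+\beta A^\top(Ax(t)-b)=0,\\ \ddot{\lambda}(t)+\dfrac{\alpha}{t}\dot{\lambda}(t)-\bigl(A(x(t)+\theta t\dot{x}(t))-b\bigr)=0,\end{cases}$$ where $\alpha\ge 3$, $\theta\in\left[\frac{1}{\alpha-1},\frac12\right]$ and $\beta\ge 0$. Then there exists $(x^*,\lambda^* )\in\Omega$ such that $(x(t),\lambda(t))\to(x^*,\lambda^* )$ as $t\to+\infty$.
   Context: Standing setting: $f:\mathbb{R}^n\to\mathbb{R}$ is convex and continuously differentiable ($\nabla f$ is not assumed Lipschitz), $A\in\mathbb{R}^{m\times n}$, $b\in\mathbb{R}^m$, $t_0>0$. The set of primal optimal solutions $\mathcal{S}=\operatorname{argmin}\{f(x): Ax=b\}$ is assumed nonempty. The primal-dual solution set is $\Omega=\{(x^*,\lambda^* )\in\mathbb{R}^n\times\mathbb{R}^m: Ax^*=b,\ \nabla f(x^* )+A^\top\lambda^*=0\}$, which is then nonempty. A trajectory is a global (twice differentiable) solution $(x,\lambda):[t_0,+\infty)\to\mathbb{R}^n\times\mathbb{R}^m$ of the system; existence of a global solution is assumed. *)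

(* Defs.v *)
From HB Require Import structures.
From mathcomp Require Import all_boot all_order all_algebra.
From mathcomp Require Import all_classical all_reals all_analysis.

Set Implicit Arguments.
Unset Strict Implicit.
Unset Printing Implicit Defensive.

Import Order.TTheory GRing.Theory Num.Theory.
Import numFieldNormedType.Exports.

Local Open Scope classical_set_scope.
Local Open Scope ring_scope.

Definition grad (R : realType) (n : nat) (f : 'cV[R]_n -> R) (x : 'cV[R]_n)
    : 'cV[R]_n :=
  \col_i 'D_(delta_mx i 0) f x.

Definition continuously_differentiable (R : realType) (n : nat)
    (f : 'cV[R]_n -> R) : Prop :=
  (forall x, differentiable f x) /\ continuous (grad f).

Definition primal_solutions (R : realType) (n m : nat) (f : 'cV[R]_n -> R)
    (A : 'M[R]_(m, n)) (b : 'cV[R]_m) : set 'cV[R]_n :=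
  [set x | A *m x = b /\ forall y, A *m y = b -> f x <= f y].

Definition primal_dual_solutions (R : realType) (n m : nat)
    (f : 'cV[R]_n -> R) (A : 'M[R]_(m, n)) (b : 'cV[R]_m)
    : set ('cV[R]_n * 'cV[R]_m) :=
  [set z | A *m z.1 = b /\ grad f z.1 + A^T *m z.2 = 0].

(* Derivative relative to a set of times: only the values of [u] on [D] count,
   so on [t0, +oo[ this is the right derivative at t0 and the usual derivative
   afterwards. *)
Definition has_derivative_within (R : realType) (k : nat) (D : set R)
    (u : R -> 'cV[R]_k) (t : R) (v : 'cV[R]_k) : Prop :=
  (s - t)^-1 *: (u s - u t) @[s --> within D t^'] --> v.

Definition is_trajectory (R : realType) (n m : nat) (f : 'cV[R]_n -> R)
    (A : 'M[R]_(m, n)) (b : 'cV[R]_m) (alpha theta beta t0 : R)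
    (x : R -> 'cV[R]_n) (lambda : R -> 'cV[R]_m) : Prop :=
  exists (dx ddx : R -> 'cV[R]_n) (dlambda ddlambda : R -> 'cV[R]_m),
    forall t, t0 <= t ->
      [/\ has_derivative_within `[t0, +oo[ x t (dx t) /\
          has_derivative_within `[t0, +oo[ dx t (ddx t),
          has_derivative_within `[t0, +oo[ lambda t (dlambda t) /\
          has_derivative_within `[t0, +oo[ dlambda t (ddlambda t),
          ddx t + (alpha / t) *: dx t + grad f (x t)
            + A^T *m (lambda t + (theta * t) *: dlambda t)
            + beta *: (A^T *m (A *m x t - b)) = 0 &
          ddlambda t + (alpha / t) *: dlambda t
            - (A *m (x t + (theta * t) *: dx t) - b) = 0].

(* Main.v *)
Require Import Defs.
From mathcomp Require Import all_boot all_order all_algebra.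
From mathcomp Require Import all_classical all_reals all_analysis.
From mathcomp Require Import ring lra.

Import Order.TTheory GRing.Theory Num.Theory.
Import numFieldNormedType.Exports.

Local Open Scope classical_set_scope.
Local Open Scope ring_scope.

Set Implicit Arguments.
Unset Strict Implicit.
Unset Printing Implicit Defensive.

(** The proof combines a Lyapunov function with one averaging principle.

    Averaging.  A function [y] solves its own first-order equation
    [y + k t y' = g]; for [k > 0] this makes [y], up to the decaying effect of
    its initial value, a weighted average of [g] with weight proportional to
    [s `^ (1/k - 1)] at time [s].  Hence bounds and limits of [y + k t y'] pass
    to [y] ([averaging_bounded], [averaging_cvg]), and a derivative [phi'] in
    [g] is averaged out as soon as [phi t / t] tends to 0
    ([averaging_cvg0_deriv]).  The energy below controls the extrapolated
    quantities [x + theta t x'] and [lambda + theta t lambda'], and this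
    principle recovers [x] and [lambda] from them.

    Energy.  For a primal-dual solution (xs, ls), the [energy] adds
    (theta t)^2 times the augmented Lagrangian gap, half the squared norms of
    the extrapolated points relative to (xs, ls), and [xi / 2] times the
    squared distance to (xs, ls), where xi = theta (alpha - 1) - 1 >= 0.  The
    skew coupling through [A] cancels in its derivative, and convexity together
    with theta <= 1/2 makes it nonincreasing.  So it converges, the
    extrapolated points are bounded, hence so are x, lambda, t x' and
    t lambda', and the gap tends to 0.  Averaging the dual equation gives
    A x - b -> 0.  Every cluster point of x is therefore primal optimal.

    Convergence of x.  For two cluster points p, q of x, keep the same
    multiplier [ls].  The difference of the two energies is then affine in
    x + k t x' along p - q, so dot x (p - q) converges; evaluating the limit at
    p and at q gives p = q.  Only convergence of the energies enters, so the
    argument covers the critical case alpha = 3, theta = 1/2, where their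
    dissipation can vanish.

    Convergence of lambda.  Once grad f (x t) converges, averaging the primal
    equation gives A^T (lambda - ls) -> 0.  For d in the kernel of A^T, the
    component dot lambda d satisfies s'' + (alpha / t) s' = 0, so
    t s' + (alpha - 1) s is constant and s converges.  The difference of two
    cluster points of lambda lies in that kernel, so lambda has a single
    cluster point.  *)

(** * Averaging of real functions *)

Section RealAsymptotics.
Context {R : realType}.
Implicit Types (h dh y dy : R -> R) (T k C l : R).

Lemma is_deriveD_pt (f g : R -> R) (t a b : R) :
  is_derive t 1 f a -> is_derive t 1 g b ->
  is_derive t 1 (fun s => f s + g s) (a + b).
Proof. exact: is_deriveD. Qed.

Lemma is_deriveB_pt (f g : R -> R) (t a b : R) :
  is_derive t 1 f a -> is_derive t 1 g b ->
  is_derive t 1 (fun s => f s - g s) (a - b).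
Proof. exact: is_deriveB. Qed.

Lemma is_deriveM_pt (f g : R -> R) (t a b : R) :
  is_derive t 1 f a -> is_derive t 1 g b ->
  is_derive t 1 (fun s => f s * g s) (a * g t + f t * b).
Proof.
move=> fa gb; apply: (is_derive_eq (is_deriveM fa gb)).
by rewrite addrC mulrC.
Qed.

Lemma is_derive_scale (c t : R) : is_derive t (1 : R) (fun s => c * s) c.
Proof.
have := is_deriveM_pt (is_derive_cst c t 1) (is_derive_id t (1 : R)).
by rewrite mul0r add0r mulr1.
Qed.

Lemma nonincreasing_after h dh T :
  (forall t, T <= t -> is_derive t 1 h (dh t)) ->
  (forall t, T <= t -> dh t <= 0) ->
  forall s t, T <= s -> s <= t -> h t <= h s.
Proof.
move=> dhE dh_le0; apply: ler0_derive1_nincry.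
- by move=> t; rewrite in_itv/= andbT => /ltW/dhE[].
- move=> t; rewrite in_itv/= andbT => /ltW Tt.
  by rewrite derive1E (@derive_val _ _ _ _ _ _ _ (dhE t Tt)) dh_le0.
- apply: derivable_within_continuous => t; rewrite in_itv/= andbT => Tt.
  by case: (dhE t Tt).
Qed.

Lemma constant_after h T :
  (forall t, T <= t -> is_derive t 1 h 0) -> forall t, T <= t -> h t = h T.
Proof.
move=> dh0 t Tt; apply/eqP; rewrite eq_le; apply/andP; split.
  exact: (@nonincreasing_after h (fun=> 0) T).
rewrite -lerN2; apply: (@nonincreasing_after (fun s => - h s) (fun=> 0) T) => //.
move=> s /dh0 dhs; have := is_deriveN dhs; rewrite oppr0.
by apply.
Qed.

Lemma nonincreasing_after_cvg h T m :
  (forall s t, T <= s -> s <= t -> h t <= h s) ->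
  (forall t, T <= t -> m <= h t) ->
  exists l, h t @[t --> +oo] --> l.
Proof.
move=> h_nincr h_ge.
(* Freezing [h] before [T] makes it monotone on the whole line. *)
pose g t := - h (Num.max T t).
have g_ndecr : nondecreasing_fun g.
  move=> s t st; rewrite lerN2; apply: h_nincr; first by rewrite le_max lexx.
  by rewrite ge_max !le_max lexx/= st orbT.
have g_ub : has_ubound (range g).
  by exists (- m) => _ [t _ <-]; rewrite lerN2 h_ge// le_max lexx.
exists (- sup (range g)).
apply: cvg_trans (cvgN (nondecreasing_cvgr g_ndecr g_ub)).
apply: near_eq_cvg; near=> t.
rewrite /g /GRing.opp/= opprK; congr h; apply: max_r.
by near: t; apply: nbhs_pinfty_ge; rewrite num_real.
Unshelve. all: by end_near. Qed.

Section Averaging.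
Variables (y dy : R -> R) (k T : R).
Hypotheses (k_gt0 : 0 < k) (T_gt0 : 0 < T).
Hypothesis dyE : forall t, T <= t -> is_derive t 1 y (dy t).

(** [t `^ (1/k)] is an integrating factor: the derivative of the left-hand
    side is [t `^ (1/k - 1) / k] times [y t + k * t * dy t - C]. *)
Lemma averaging_powR C :
  (forall t, T <= t -> y t + k * t * dy t <= C) ->
  forall t, T <= t -> t `^ k^-1 * (y t - C) <= T `^ k^-1 * (y T - C).
Proof.
move=> avg_le t Tt.
pose dg s := (k^-1 * s `^ (k^-1 - 1)) * (y s - C) + s `^ k^-1 * (dy s - 0).
apply: (@nonincreasing_after (fun s => s `^ k^-1 * (y s - C)) dg T) => //.
- move=> s Ts; apply: is_deriveM_pt.
    by apply: is_derive1_powR; exact: lt_le_trans Ts.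
  by apply: is_deriveB_pt; exact: dyE.
- move=> s Ts; have s_gt0 : 0 < s by exact: lt_le_trans Ts.
  rewrite /dg -(mulr_powRB1 (ltW s_gt0) (p := k^-1)) ?invr_gt0// subr0.
  have -> : k^-1 * s `^ (k^-1 - 1) * (y s - C) + s * s `^ (k^-1 - 1) * dy s
      = k^-1 * s `^ (k^-1 - 1) * (y s + k * s * dy s - C).
    by field; rewrite gt_eqF.
  rewrite mulr_ge0_le0 ?subr_le0 ?avg_le//.
  by rewrite mulr_ge0 ?powR_ge0// invr_ge0 ltW.
Qed.

Lemma averaging_bound C :
  (forall t, T <= t -> y t + k * t * dy t <= C) ->
  forall t, T <= t -> y t <= Num.max C (y T).
Proof.
move=> avg_le t Tt; have t_gt0 : 0 < t by exact: lt_le_trans Tt.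
have avg_le' s : T <= s -> y s + k * s * dy s <= Num.max C (y T).
  by move=> /avg_le; rewrite le_max => ->.
rewrite -subr_le0 -(@pmulr_rle0 _ (t `^ k^-1)) ?powR_gt0//.
apply: (le_trans (averaging_powR avg_le' Tt)).
by rewrite mulr_ge0_le0 ?powR_ge0// subr_le0 le_max lexx orbT.
Qed.

(** The excess over [C] is at most a constant times [t `^ (- 1/k)]. *)
Lemma averaging_limsup C :
  (forall t, T <= t -> y t + k * t * dy t <= C) ->
  forall e, 0 < e -> \forall t \near +oo, y t <= C + e.
Proof.
move=> avg_le e e_gt0; set D := T `^ k^-1 * (y T - C).
near=> t.
have Tt : T <= t by near: t; apply: nbhs_pinfty_ge; rewrite num_real.
have t_gt0 : 0 < t by exact: lt_le_trans Tt.
have := averaging_powR avg_le Tt; rewrite -/D => tD.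
rewrite -lerBlDl -(ler_pM2l (powR_gt0 k^-1 t_gt0)).
apply: (le_trans tD).
have ke_gt0 : 0 < `|D| / e + 1 by rewrite ltr_wpDl// divr_ge0// ltW.
have : (`|D| / e + 1) <= t `^ k^-1.
  (* The threshold (`|D| / e + 1) `^ k on [t] makes [t `^ (1/k)] large enough. *)
  have -> : `|D| / e + 1 = ((`|D| / e + 1) `^ k) `^ k^-1.
    by rewrite -powRrM mulfV ?gt_eqF// powRr1// ltW.
  apply: ge0_ler_powR; rewrite ?nnegrE ?invr_ge0 ?powR_ge0 ?ltW//.
rewrite -(ler_pM2r e_gt0) mulrDl divfK ?gt_eqF// mul1r => /(le_trans _); apply.
by rewrite (le_trans (ler_norm _))// lerDl ltW.
Unshelve. all: by end_near. Qed.

End Averaging.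

Lemma averaging_cvg y dy k T l :
  0 < k -> 0 < T -> (forall t, T <= t -> is_derive t 1 y (dy t)) ->
  y t + k * t * dy t @[t --> +oo] --> l -> y t @[t --> +oo] --> l.
Proof.
move=> k_gt0 T_gt0 dyE avg_l; apply/cvgrPdist_le => e e_gt0.
have e2_gt0 : 0 < e / 2 by rewrite divr_gt0.
have /cvgrPdist_le/(_ _ e2_gt0)[M [_ avg_near]] := avg_l.
pose T' := Num.max T (M + 1).
have TT' t : T' <= t -> T <= t by rewrite ge_max => /andP[].
have T'_gt0 : 0 < T' by rewrite lt_max T_gt0.
have avg_near' t : T' <= t -> `|l - (y t + k * t * dy t)| <= e / 2.
  by rewrite ge_max => /andP[_ Mt]; apply: avg_near; lra.
have up : \forall t \near +oo, y t <= l + e / 2 + e / 2.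
  apply: (@averaging_limsup y dy k T') => // [t /TT'/dyE//|t /avg_near'].
  by rewrite ler_distlC => /andP[].
have down : \forall t \near +oo, - y t <= - (l - e / 2) + e / 2.
  apply: (@averaging_limsup (fun t => - y t) (fun t => - dy t) k T') => //.
    by move=> t /TT'/dyE; exact: is_deriveN.
  by move=> t /avg_near'; rewrite ler_distlC => /andP[+ _]; lra.
near=> t.
have : y t <= l + e / 2 + e / 2 by near: t.
have : - y t <= - (l - e / 2) + e / 2 by near: t.
by rewrite ler_distlC => ? ?; apply/andP; split; lra.
Unshelve. all: by end_near. Qed.

Lemma averaging_bounded y dy k T C :
  0 < k -> 0 < T -> (forall t, T <= t -> is_derive t 1 y (dy t)) ->
  (forall t, T <= t -> `|y t + k * t * dy t| <= C) ->
  exists D, forall t, T <= t -> `|y t| <= D /\ `|t * dy t| <= D.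
Proof.
move=> k_gt0 T_gt0 dyE avg_le; pose D := Num.max C `|y T|.
have y_le t : T <= t -> `|y t| <= D.
  move=> Tt; rewrite ler_norml; apply/andP; split.
    rewrite lerNl; apply: le_trans (_ : Num.max C (- y T) <= D).
      apply: (@averaging_bound (fun t => - y t) (fun t => - dy t) k T) => //.
        by move=> s /dyE; exact: is_deriveN.
      by move=> s /avg_le; rewrite ler_norml => /andP[+ _]; lra.
    by rewrite /D ge_max !le_max lexx -normrN ler_norm orbT.
  apply: le_trans (_ : Num.max C (y T) <= D).
    apply: (@averaging_bound y dy k T) => // s /avg_le.
    by rewrite ler_norml => /andP[].
  by rewrite /D ge_max !le_max lexx ler_norm orbT.
have C_ge0 : 0 <= C by apply: le_trans (avg_le T _).
have D_ge0 : 0 <= D by rewrite /D le_max C_ge0.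
exists (D + (C + D) / k) => t Tt; split.
  by rewrite (le_trans (y_le t Tt))// lerDl divr_ge0 ?addr_ge0// ltW.
apply: le_trans (_ : (C + D) / k <= _); last by rewrite lerDr.
rewrite ler_pdivlMr// -[X in _ * X](gtr0_norm k_gt0) -normrM.
(* The velocity is recovered from the average and the position. *)
have -> : t * dy t * k = y t + k * t * dy t - y t by ring.
by rewrite (le_trans (ler_normB _ _))// lerD ?avg_le ?y_le.
Qed.

Lemma bounded_div_cvg0 (g : R -> R) T D :
  (forall t, T <= t -> `|g t| <= D) -> g t / t @[t --> +oo] --> (0 : R).
Proof.
move=> g_le; apply/cvgrPdist_le => e e_gt0; near=> t.
have t_gt0 : 0 < t by near: t; apply: nbhs_pinfty_gt; rewrite num_real.
rewrite sub0r normrN normrM normfV (gtr0_norm t_gt0) ler_pdivrMr//.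
rewrite (le_trans (g_le t _))//.
by rewrite mulrC -ler_pdivrMr.
Unshelve. all: by end_near. Qed.

(** The term [dphi] need not tend to 0, but y - phi / (k t) has averaged
    quantity e + (1 - 1/k) phi / t, from which [dphi] has disappeared. *)
Lemma averaging_cvg0_deriv y dy (phi dphi e : R -> R) k T :
  0 < k -> 0 < T -> (forall t, T <= t -> is_derive t 1 y (dy t)) ->
  (forall t, T <= t -> is_derive t 1 phi (dphi t)) ->
  (forall t, T <= t -> y t + k * t * dy t = e t + dphi t) ->
  e t @[t --> +oo] --> (0 : R) -> phi t / t @[t --> +oo] --> (0 : R) ->
  y t @[t --> +oo] --> (0 : R).
Proof.
move=> k_gt0 T_gt0 dyE dphiE eq_avg e0 phi0.
have k_neq0 : k != 0 by rewrite gt_eqF.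
pose w t := y t - k^-1 * (phi t / t).
pose dw t := dy t - (0 * (phi t / t) + k^-1 * (dphi t / t + phi t * (- t ^- 2 * 1))).
have dwE t : T <= t -> is_derive t 1 w (dw t).
  move=> Tt; have t_neq0 : t != 0 by rewrite gt_eqF// (lt_le_trans T_gt0).
  apply: is_deriveB_pt; first exact: dyE.
  apply: is_deriveM_pt.
  apply: is_deriveM_pt; first exact: dphiE.
  exact: (@is_deriveV _ id t 1 1).
have w0 : w t @[t --> +oo] --> (0 : R).
  apply: (@averaging_cvg w dw k T) => //.
  have : e t + (1 - k^-1) * (phi t / t) @[t --> +oo] --> (0 : R).
    by have := cvgD e0 (cvgMl_tmp (a := 1 - k^-1) phi0); rewrite mulr0 addr0; apply.
  apply: cvg_trans; apply: near_eq_cvg; near=> t.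
  have Tt : T <= t by near: t; apply: nbhs_pinfty_ge; rewrite num_real.
  have t_neq0 : t != 0 by rewrite gt_eqF// (lt_le_trans T_gt0).
  have := eq_avg t Tt; rewrite /w /dw => eq_t.
  have -> : e t = y t + k * t * dy t - dphi t by rewrite eq_t addrK.
  by field; rewrite t_neq0.
have : w t + k^-1 * (phi t / t) @[t --> +oo] --> (0 : R).
  by have := cvgD w0 (cvgMl_tmp (a := k^-1) phi0); rewrite mulr0 addr0; apply.
by under eq_cvg do rewrite /w subrK.
Unshelve. all: by end_near. Qed.

End RealAsymptotics.

(** * Scalar product and limits of column vectors *)

(** The norm on column vectors is the maximum of the coordinates, which
    carries no scalar product; the energy needs the Euclidean one. *)
Definition dot (R : realType) (n : nat) (u v : 'cV[R]_n) : R :=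
  \sum_i u i 0 * v i 0.

Section DotProduct.
Context {R : realType} {n : nat}.
Implicit Types (u v w : 'cV[R]_n) (a : R).

Lemma dotC u v : dot u v = dot v u.
Proof. by apply: eq_bigr => i _; rewrite mulrC. Qed.

Lemma dotDl u v w : dot (u + v) w = dot u w + dot v w.
Proof. by rewrite -big_split; apply: eq_bigr => i _; rewrite mxE mulrDl. Qed.

Lemma dotZl a u w : dot (a *: u) w = a * dot u w.
Proof. by rewrite mulr_sumr; apply: eq_bigr => i _; rewrite mxE mulrA. Qed.

Lemma dotNl u w : dot (- u) w = - dot u w.
Proof. by rewrite -scaleN1r dotZl mulN1r. Qed.

Lemma dotDr u v w : dot u (v + w) = dot u v + dot u w.
Proof. by rewrite dotC dotDl !(dotC u). Qed.

Lemma dotZr a u w : dot u (a *: w) = a * dot u w.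
Proof. by rewrite dotC dotZl dotC. Qed.

Lemma dotNr u w : dot u (- w) = - dot u w.
Proof. by rewrite dotC dotNl dotC. Qed.

Definition dotE := (dotDl, dotDr, dotZl, dotZr, dotNl, dotNr).

Lemma dot0l w : dot 0 w = 0.
Proof. by rewrite -(scale0r 0) dotZl mul0r. Qed.

Lemma dot_ge0 u : 0 <= dot u u.
Proof. by apply: sumr_ge0 => i _; rewrite -expr2 sqr_ge0. Qed.

Lemma sqr_coord_le_dot u i : u i 0 ^+ 2 <= dot u u.
Proof.
rewrite /dot (bigD1 i)//= -expr2 lerDl.
by apply: sumr_ge0 => j _; rewrite -expr2 sqr_ge0.
Qed.

Lemma dot_eq0 u : dot u u = 0 -> u = 0.
Proof.
move=> uu0; apply/colP => i; rewrite mxE; apply/eqP.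
by rewrite -(sqrf_eq0 (u i 0)) eq_le sqr_ge0 -uu0 sqr_coord_le_dot.
Qed.

Lemma dot_le_eq0 u : (forall v, 0 <= dot u v) -> u = 0.
Proof.
move=> /(_ (- u)); rewrite dotNr oppr_ge0 => uu_le0.
by apply: dot_eq0; apply/eqP; rewrite eq_le uu_le0 dot_ge0.
Qed.

End DotProduct.

Lemma dot_mulmx (R : realType) (n m : nat) (A : 'M[R]_(m, n)) u v :
  dot u (A^T *m v) = dot (A *m u) v.
Proof.
rewrite /dot; under eq_bigr do rewrite mxE mulr_sumr.
under [RHS]eq_bigr do rewrite mxE mulr_suml.
rewrite exchange_big; apply: eq_bigr => i _; apply: eq_bigr => j _.
by rewrite mxE mulrCA mulrA.
Qed.

Section VectorLimits.
Context {R : realType}.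

Lemma cvg_cV (k : nat) (I : Type) (F : set_system I) {FF : Filter F}
    (u : I -> 'cV[R]_k) (l : 'cV[R]_k) :
  (forall i, u t i 0 @[t --> F] --> l i 0) -> u t @[t --> F] --> l.
Proof.
move=> ul; apply/cvg_ballP => e e_gt0.
have := @filter_forall _ _ _ F FF (fun i => cvg_ball (ul i) e_gt0).
move=> near_ball; near=> t.
have ut : forall i, ball (l i 0) e (u t i 0) by near: t; exact: (near_ball FF).
by split=> // i j; rewrite ord1; exact: ut.
Unshelve. all: by end_near. Qed.

Lemma cvg_coord (k : nat) (I : Type) (F : set_system I) {FF : Filter F}
    (u : I -> 'cV[R]_k) (l : 'cV[R]_k) i :
  u t @[t --> F] --> l -> u t i 0 @[t --> F] --> l i 0.
Proof.
move=> ul.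
apply: (cvg_comp u (fun v : 'cV[R]_k => v i 0) ul).
exact: coord_continuous.
Qed.

Lemma cvg_dot (k : nat) (I : Type) (F : set_system I) {FF : Filter F}
    (u v : I -> 'cV[R]_k) (p q : 'cV[R]_k) :
  u t @[t --> F] --> p -> v t @[t --> F] --> q ->
  dot (u t) (v t) @[t --> F] --> dot p q.
Proof.
move=> up vq; rewrite /dot.
by apply: cvg_big => [|i _]; [exact: add_continuous|]; apply: cvgM; exact: cvg_coord.
Qed.

Lemma cvg_mulmx (k l : nat) (I : Type) (F : set_system I) {FF : Filter F}
    (B : 'M[R]_(l, k)) (u : I -> 'cV[R]_k) (p : 'cV[R]_k) :
  u t @[t --> F] --> p -> B *m u t @[t --> F] --> B *m p.
Proof.
move=> up; apply: cvg_cV => i; rewrite mxE.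
under eq_cvg do rewrite mxE.
by apply: cvg_big => [|j _]; [exact: add_continuous|]; apply: cvgMl_tmp; exact: cvg_coord.
Qed.

(** Transposition of the compactness of products of segments for row
    vectors. *)
Lemma compact_box (k : nat) (D : R) :
  compact [set v : 'cV[R]_k | forall i, `|v i 0| <= D].
Proof.
have rV_box : compact [set v : 'rV[R]_k | forall i, `[- D, D]%classic (v ord0 i)].
  by apply: (@rV_compact R k (fun=> `[- D, D]%classic)) => _; exact: segment_compact.
have trmx_cont : continuous (fun v : 'rV[R]_k => v^T).
  move=> v; apply: (@cvg_cV _ _ (nbhs v) (nbhs_filter v)) => i; rewrite mxE.
  under eq_cvg do rewrite mxE.
  exact: coord_continuous.
rewrite (_ : [set _ | _] = (fun v : 'rV[R]_k => v^T) @`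
    [set v : 'rV[R]_k | forall i, `[- D, D]%classic (v ord0 i)]).
  apply: continuous_compact => //; exact: continuous_subspaceT.
apply/seteqP; split=> v /=.
  move=> v_le; exists v^T; last by rewrite trmxK.
  by move=> i /=; rewrite in_itv/= mxE -ler_norml.
by move=> [w w_le <-] i; rewrite mxE ler_norml; have := w_le i; rewrite /= in_itv.
Qed.

Lemma cluster_limit (k : nat) (V : pseudoMetricNormedZmodType R)
    (u : R -> 'cV[R]_k) (g : 'cV[R]_k -> V) p l :
  cluster (u t @[t --> +oo]) p -> {for p, continuous g} ->
  g (u t) @[t --> +oo] --> l -> g p = l.
Proof.
rewrite cluster_cvgE => -[G GP [Gp uG]] gp gul.
have gGp : g @ G --> g p by apply: (cvg_comp _ _ Gp).
apply: (norm_cvg_unique gGp).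
apply: (cvg_trans _ gul) => B.
exact: uG.
Qed.

Lemma cvg_cluster_pinfty (k : nat) (u : R -> 'cV[R]_k) p :
  u t @[t --> +oo] --> p -> cluster (u t @[t --> +oo]) p.
Proof.
move=> up B C uB pC.
exact: (@filter_ex _ (u t @[t --> +oo]) _ _ (filterI uB (up C pC))).
Qed.

(** If [p] and [q] are cluster points, the limit of dot (u t) (p - q) equals
    both dot p (p - q) and dot q (p - q), so dot (p - q) (p - q) = 0.  The
    hypothesis is thus what uniqueness of the cluster point needs, and on a
    compact set uniqueness is convergence. *)
Lemma cvg_of_clusters (k : nat) (u : R -> 'cV[R]_k) (T : R) :
  (forall i, exists D, forall t, T <= t -> `|u t i 0| <= D) ->
  (forall p q : 'cV[R]_k, cluster (u t @[t --> +oo]) p -> cluster (u t @[t --> +oo]) q ->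
    exists l : R, dot (u t) (p - q) @[t --> +oo] --> l) ->
  exists p : 'cV[R]_k, u t @[t --> +oo] --> p.
Proof.
move=> /choice[D_ uD_le] u_dot; pose D := \sum_i `|D_ i|.
have u_le t : T <= t -> forall i, `|u t i 0| <= D.
  move=> Tt i; apply: le_trans (uD_le i t Tt) _.
  rewrite /D (bigD1 i)//= (le_trans (ler_norm _))// lerDl.
  by apply: sumr_ge0 => j _.
set F := (u t @[t --> +oo]).
have FP : ProperFilter F by apply: fmap_proper_filter.
have F_box e : D <= e -> F [set v | forall i, `|v i 0| <= e].
  move=> De; rewrite /F /fmap /=; near=> t => i.
  by apply: le_trans De; apply: u_le.
have [p [p_box Fp]] := compact_box FP (F_box D (lexx D)).
(* The box of radius [D + 1], unlike that of radius [D], is a neighbourhood of [p]. *)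
exists p; apply: (@compact_cluster_set1 _ p F [set v | forall i, `|v i 0| <= D + 1]).
- exact: norm_hausdorff.
- exact: compact_box.
- apply/nbhs_ballP; exists 1 => //= v [_ pv] i.
  have /ltW := pv i 0; rewrite distrC => vp_le1.
  by rewrite -[v i 0](subrK (p i 0)) (le_trans (ler_normD _ _))// addrC lerD.
- by apply: F_box; rewrite lerDl.
- apply/seteqP; split=> [q Fq|_ ->//]; apply/eqP; rewrite eq_sym -subr_eq0.
  apply/eqP/dot_eq0; rewrite dotDl dotNl.
  have [l upq] := u_dot p q Fp Fq.
  have dot_cont (v w : 'cV[R]_k) : {for w, continuous (fun z => dot z v)}.
    apply: (@cvg_dot _ _ (nbhs w) (nbhs_filter w) id (fun=> v)); first exact: cvg_id.
    exact: cvg_cst.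
  have -> := cluster_limit Fp (@dot_cont (p - q) p) upq.
  by rewrite (cluster_limit Fq (@dot_cont (p - q) q) upq) subrr.
Unshelve. all: by end_near. Qed.

End VectorLimits.

(** * Derivatives of vector-valued functions, convexity and optimality *)

Section VectorDerivatives.
Context {R : realType}.
Implicit Types (t : R).

(** Strictly after [t0] the constraint on the half-line is void near [t]. *)
Lemma is_derive_within (k : nat) (u : R -> 'cV[R]_k) (t0 t : R) (v : 'cV[R]_k) :
  t0 < t -> has_derivative_within `[t0, +oo[ u t v -> is_derive t 1 u v.
Proof.
move=> t0t uv.
have quotient_cvg :
    h^-1 *: ((u \o shift t) (h *: 1) - u t) @[h --> (0 : R)^'] --> v.
  move=> U /uv[e /= e_gt0 eU].
  suff : \forall h \near (0 : R)^', U (h^-1 *: ((u \o shift t) (h *: 1) - u t)) by [].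
  near=> h; rewrite /= [h *: 1]mulr1.
  have h_neq0 : h != 0 by near: h; exact: nbhs_dnbhs_neq.
  have := eU (h + t); rewrite addrK; apply.
  - rewrite /ball/= opprD addrC subrK normrN.
    near: h; exact: dnbhs0_lt.
  - by rewrite -subr_eq0 addrK.
  - rewrite /= in_itv/= andbT -lerBlDr.
    have : `|h| < t - t0 by near: h; apply: dnbhs0_lt; rewrite subr_gt0.
    rewrite ltr_norml => /andP[/ltW + _]; by rewrite opprB.
by apply: DeriveDef; [apply/cvg_ex; exists v | exact: cvg_lim].
Unshelve. all: by end_near. Qed.

Lemma is_derive_cVP (k : nat) (u : R -> 'cV[R]_k) t (v : 'cV[R]_k) :
  is_derive t 1 u v <-> forall i, is_derive t 1 (fun s => u s i 0) (v i 0).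
Proof.
split=> [[u_derivable <-] i|u_coord].
  rewrite derive_mx// mxE; apply: derivableP.
  exact: (derivable_mxP _ _ _).1.
have u_derivable : derivable u t 1.
  by apply/derivable_mxP => i j; rewrite ord1; have [] := u_coord i.
apply: DeriveDef => //; rewrite derive_mx//.
by apply/colP => i; rewrite mxE; have [_ ->] := u_coord i.
Qed.

Lemma is_derive_coord (k : nat) (u : R -> 'cV[R]_k) t v i :
  is_derive t 1 u v -> is_derive t 1 (fun s => u s i 0) (v i 0).
Proof. by move=> /is_derive_cVP. Qed.

Lemma is_derive_sum_pt (k : nat) (F : 'I_k -> R -> R) t (dF : 'I_k -> R) :
  (forall i, is_derive t 1 (F i) (dF i)) ->
  is_derive t 1 (fun s => \sum_i F i s) (\sum_i dF i).
Proof.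
move=> FdF; have := is_derive_sum FdF.
rewrite (_ : \sum_i F i = (fun s => \sum_i F i s))//.
by apply/funext => s; rewrite fct_sumE.
Qed.

Lemma is_derive_dot (k : nat) (u v : R -> 'cV[R]_k) t du dv :
  is_derive t 1 u du -> is_derive t 1 v dv ->
  is_derive t 1 (fun s => dot (u s) (v s)) (dot du (v t) + dot (u t) dv).
Proof.
move=> udu vdv; rewrite /dot -big_split/=.
by apply: is_derive_sum_pt => i; apply: is_deriveM_pt; exact: is_derive_coord.
Qed.

Lemma is_derive_dot_sqr k (u : R -> 'cV[R]_k) (t : R) du :
  is_derive t 1 u du -> is_derive t 1 (fun s => dot (u s) (u s)) (2 * dot (u t) du).
Proof.
move=> udu; apply: is_derive_eq (is_derive_dot udu udu) _.
by rewrite (dotC du); ring.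
Qed.

Lemma is_deriveD_cV (k : nat) (u v : R -> 'cV[R]_k) t du dv :
  is_derive t 1 u du -> is_derive t 1 v dv ->
  is_derive t 1 (fun s => u s + v s) (du + dv).
Proof. exact: is_deriveD. Qed.

Lemma is_deriveB_cst (k : nat) (u : R -> 'cV[R]_k) t du c :
  is_derive t 1 u du -> is_derive t 1 (fun s => u s - c) du.
Proof.
move=> udu; apply/is_derive_cVP => i.
rewrite (_ : (fun s => _) = (fun s => u s i 0 - c i 0)); last first.
  by apply/funext => s; rewrite !mxE.
rewrite -[du i 0]subr0; apply: is_deriveB_pt; exact: is_derive_coord.
Qed.

Lemma is_deriveZ_cV (k : nat) (a : R -> R) (u : R -> 'cV[R]_k) t da du :
  is_derive t 1 a da -> is_derive t 1 u du ->
  is_derive t 1 (fun s => a s *: u s) (da *: u t + a t *: du).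
Proof.
move=> ada udu; apply/is_derive_cVP => i.
rewrite (_ : (fun s => _) = (fun s => a s * u s i 0)); last first.
  by apply/funext => s; rewrite !mxE.
by rewrite !mxE; apply: is_deriveM_pt; exact: is_derive_coord.
Qed.

Lemma is_derive_mulmx (k l : nat) (B : 'M[R]_(l, k)) (u : R -> 'cV[R]_k) t du :
  is_derive t 1 u du -> is_derive t 1 (fun s => B *m u s) (B *m du).
Proof.
move=> udu; apply/is_derive_cVP => i.
rewrite (_ : (fun s => _) = (fun s => \sum_j B i j * u s j 0)); last first.
  by apply/funext => s; rewrite !mxE.
rewrite mxE; apply: is_derive_sum_pt => j.
have := is_derive_coord j udu => uj.
by rewrite -[_ * du _ _]add0r -(mul0r (u t j 0)); apply: is_deriveM_pt.
Qed.

End VectorDerivatives.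

Section Convexity.
Context {R : realType} {n : nat} (f : 'cV[R]_n -> R).
Hypothesis f_diff : forall x, differentiable f x.

Lemma diff_grad x v : 'd f x v = dot (grad f x) v.
Proof.
rewrite {1}[v]matrix_sum_delta linear_sum; apply: eq_bigr => i _.
rewrite big_ord1 linearZ mxE deriveE// mulrC.
by rewrite -[LHS]/(v i 0 *: _); congr (_ *: _); congr ('d f x (delta_mx i _)).
Qed.

Lemma is_derive_along (u : R -> 'cV[R]_n) (t : R) (du : 'cV[R]_n) :
  is_derive t 1 u du -> is_derive t 1 (f \o u) (dot (grad f (u t)) du).
Proof.
move=> [u_derivable <-].
have u_diff : differentiable u t by exact/derivable1_diffP.
have fu_diff : differentiable (f \o u) t by exact: differentiable_comp.
apply: DeriveDef; first exact/derivable1_diffP.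
by rewrite deriveE// diff_comp//= diff_grad deriveE.
Qed.

(** One-sided limits suffice below, where both convexity and optimality only
    speak of small positive steps. *)
Lemma grad_right_quotient (x v : 'cV[R]_n) :
  h^-1 * (f (x + h *: v) - f x) @[h --> (0 : R)^'+] --> dot (grad f x) v.
Proof.
have : h^-1 *: ((f \o shift x) (h *: v) - f x) @[h --> (0 : R)^']
    --> dot (grad f x) v.
  by rewrite -diff_grad -deriveE//; exact: diff_derivable.
move/cvg_dnbhs_at_right; apply: cvg_trans; apply: near_eq_cvg; near=> h.
by rewrite /= [h *: v + x]addrC.
Unshelve. all: by end_near. Qed.

Lemma grad_ge (x v : 'cV[R]_n) (c : R) :
  (forall h, 0 < h -> c * h <= f (x + h *: v) - f x) -> c <= dot (grad f x) v.
Proof.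
move=> f_ge; apply: (cvgr_to_ge (@grad_right_quotient x v)).
near=> h; have h_gt0 : 0 < h by [].
by rewrite mulrC ler_pdivlMr// f_ge.
Unshelve. all: by end_near. Qed.

Lemma convex_grad_le (x y : 'cV[R]_n) :
  convex_function [set: 'cV[R]_n] f -> dot (grad f x) (y - x) <= f y - f x.
Proof.
move=> f_convex; apply: (cvgr_to_le (@grad_right_quotient x (y - x))).
near=> h; have h_gt0 : 0 < h by [].
have h_le1 : h <= 1 by near: h; exact: nbhs_right_le.
rewrite mulrC ler_pdivrMr//.
have f_le : f (h *: y + (1 - h) *: x) <= h * f y + (1 - h) * f x.
  exact: (f_convex (Itv01 (ltW h_gt0) h_le1) y x (in_setT _) (in_setT _)).
have -> : x + h *: (y - x) = h *: y + (1 - h) *: x.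
  by rewrite scalerBr scalerBl scale1r addrCA.
by apply: le_trans (lerB f_le (lexx _)) _; lra.
Unshelve. all: by end_near. Qed.

End Convexity.

Section Optimality.
Context {R : realType} {n m : nat} (f : 'cV[R]_n -> R) (A : 'M[R]_(m, n)) (b : 'cV[R]_m).
Hypothesis f_diff : forall x, differentiable f x.

(** Lagrange multipliers for linear constraints: the gradient at a minimizer
    is orthogonal to the kernel of [A], spanned by the columns of
    [cokermx A], hence lies in the row space of [A]. *)
Lemma multiplier_exists x :
  primal_solutions f A b x -> exists l, primal_dual_solutions f A b (x, l).
Proof.
move=> [Axb x_min].
have grad_ker_ge0 d : A *m d = 0 -> 0 <= dot (grad f x) d.
  move=> Ad0; apply: grad_ge => // h _.
  by rewrite mul0r subr_ge0 x_min// mulmxDr -scalemxAr Ad0 scaler0 addr0.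
have grad_ker d : A *m d = 0 -> dot (grad f x) d = 0.
  move=> Ad0; apply/eqP; rewrite eq_le grad_ker_ge0// andbT -oppr_ge0 -dotNr.
  by rewrite grad_ker_ge0// mulmxN Ad0 oppr0.
have : ((grad f x)^T <= A)%MS.
  rewrite submxE; apply/eqP/matrixP => i j; rewrite ord1 [RHS]mxE.
  have := grad_ker (col j (cokermx A)).
  rewrite colE mulmxA mulmx_coker mul0mx => /(_ erefl) <-.
  rewrite mxE; apply: eq_bigr => k _.
  by rewrite -colE !mxE.
move=> /submxP[D gradE]; exists (- D^T); split=> //=.
by rewrite -(trmxK (grad f x)) gradE trmx_mul mulmxN subrr.
Qed.

(** A feasible point with the optimal value minimizes the Lagrangian
    f + dot (A _ - b) l, whose minimum over the whole space is [f x]; so its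
    gradient vanishes there with the same multiplier [l].  All primal solutions
    thus share their multipliers. *)
Lemma saddle_value_optimal x l p :
  convex_function [set: 'cV[R]_n] f ->
  primal_dual_solutions f A b (x, l) -> A *m p = b -> f p = f x ->
  primal_dual_solutions f A b (p, l).
Proof.
move=> f_convex [/= Axb gradx] Apb fpx; split=> //=.
apply: dot_le_eq0 => d.
rewrite /= dotDl (dotC (A^T *m l)) dot_mulmx -lerBlDr sub0r.
apply: grad_ge => // h h_gt0.
have := convex_grad_le f_diff x (p + h *: d) f_convex.
have -> : grad f x = - (A^T *m l) by apply/eqP; rewrite -addr_eq0 gradx.
rewrite fpx => /(le_trans _); apply.
rewrite dotNl (dotC (A^T *m l)) dot_mulmx mulmxBr mulmxDr -scalemxAr Axb Apb.
by rewrite addrAC subrr add0r dotZl mulNr mulrC.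
Qed.

End Optimality.

(** * The primal-dual dynamics *)

(** With [dot_dual_force], the algebra behind the cancellation of the skew
    coupling: for y = A v and z = w, the term dot (A v) w enters with opposite
    signs. *)
Lemma dot_primal_force (R : realType) (n m : nat) (A : 'M[R]_(m, n))
    (v d g : 'cV[R]_n) (z l r : 'cV[R]_m) (a c e : R) :
  dot v (- (a *: d) - c *: (g + A^T *m (z + l) + e *: (A^T *m r)))
  = - a * dot v d - c * (dot v g + (dot (A *m v) z + dot (A *m v) l)
                         + e * dot (A *m v) r).
Proof. by rewrite !dotE !dot_mulmx !dotE; ring. Qed.

Lemma dot_dual_force (R : realType) (m : nat) (w d y : 'cV[R]_m) (a c : R) :
  dot w (- (a *: d) + c *: y) = - a * dot w d + c * dot y w.
Proof. by rewrite !dotE (dotC w y); ring. Qed.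

(** The part quadratic in [u] and [d] does not depend on the centre, so it
    drops out of the difference. *)
Lemma dot_shift_difference (R : realType) (n : nat) (u d p q : 'cV[R]_n) :
  dot (u - q + d) (u - q + d) - dot (u - p + d) (u - p + d)
  = 2 * dot (u + d) (p - q) + (dot q q - dot p p).
Proof. by rewrite !dotE !(dotC p u, dotC q u, dotC p d, dotC q d, dotC d u); ring. Qed.

Section Trajectory.
Context {R : realType} {n m : nat} (f : 'cV[R]_n -> R) (A : 'M[R]_(m, n)).
Context (b : 'cV[R]_m) (alpha theta beta T : R).
Context (x dx ddx : R -> 'cV[R]_n) (lambda dlambda ddlambda : R -> 'cV[R]_m).
Hypothesis f_convex : convex_function [set: 'cV[R]_n] f.
Hypothesis f_diff : forall p, differentiable f p.
Hypothesis grad_continuous : continuous (grad f).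
Hypothesis T_gt0 : 0 < T.
Hypothesis alpha_gt1 : 1 < alpha.
Hypothesis theta_lb : 1 <= theta * (alpha - 1).
Hypothesis theta_ub : theta <= 1 / 2.
Hypothesis beta_ge0 : 0 <= beta.
Hypothesis dxE : forall t, T <= t -> is_derive t 1 x (dx t).
Hypothesis ddxE : forall t, T <= t -> is_derive t 1 dx (ddx t).
Hypothesis dlambdaE : forall t, T <= t -> is_derive t 1 lambda (dlambda t).
Hypothesis ddlambdaE : forall t, T <= t -> is_derive t 1 dlambda (ddlambda t).
Hypothesis primal_eq : forall t, T <= t ->
  ddx t + (alpha / t) *: dx t + grad f (x t)
    + A^T *m (lambda t + (theta * t) *: dlambda t)
    + beta *: (A^T *m (A *m x t - b)) = 0.
Hypothesis dual_eq : forall t, T <= t ->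
  ddlambda t + (alpha / t) *: dlambda t
    - (A *m (x t + (theta * t) *: dx t) - b) = 0.

Let xi := theta * (alpha - 1) - 1.
Let residual t := A *m x t - b.

Let theta_gt0 : 0 < theta.
Proof.
rewrite -(@pmulr_lgt0 _ (alpha - 1)) ?subr_gt0//.
by apply: lt_le_trans theta_lb.
Qed.

Let xi_ge0 : 0 <= xi. Proof. by rewrite subr_ge0. Qed.

Let pos t : T <= t -> 0 < t. Proof. exact: lt_le_trans. Qed.

(** ** Energy estimates *)

Section Energy.
Context (xs : 'cV[R]_n) (ls : 'cV[R]_m).
Hypothesis xls_solution : primal_dual_solutions f A b (xs, ls).

(** Augmented Lagrangian L(x, l) = f x + dot (A x - b) l + beta/2 |A x - b|^2
    at (x t, ls), minus its value f xs at (xs, ls). *)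
Definition lagrangian_gap t :=
  f (x t) - f xs + dot (residual t) ls + beta / 2 * dot (residual t) (residual t).

Let v t := x t - xs + (theta * t) *: dx t.
Let w t := lambda t - ls + (theta * t) *: dlambda t.

(** [v] and [w] are the extrapolated primal and dual points relative to
    (xs, ls). *)
Definition energy t :=
  theta * t * (theta * t) * lagrangian_gap t
  + (dot (v t) (v t) + dot (w t) (w t)) / 2
  + xi / 2 * (dot (x t - xs) (x t - xs) + dot (lambda t - ls) (lambda t - ls)).

Lemma residualE t : residual t = A *m (x t - xs).
Proof. by case: xls_solution => /= Axs _; rewrite mulmxBr Axs. Qed.

Lemma lagrangian_gap_ge0 t : 0 <= lagrangian_gap t.
Proof.
have [/= Axs gradxs] := xls_solution.
rewrite /lagrangian_gap addr_ge0 ?mulr_ge0 ?dot_ge0 ?divr_ge0//.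
rewrite residualE -dot_mulmx -lerBlDr sub0r -dotNr.
have -> : - (A^T *m ls) = grad f xs by apply/esym/eqP; rewrite -addr_eq0 gradxs.
by rewrite dotC convex_grad_le.
Qed.

Lemma is_derive_residual t :
  T <= t -> is_derive t 1 residual (A *m dx t).
Proof. by move=> Tt; apply: is_deriveB_cst; apply: is_derive_mulmx; exact: dxE. Qed.

Lemma is_derive_gap t : T <= t ->
  is_derive t 1 lagrangian_gap (dot (grad f (x t)) (dx t) + dot (A *m dx t) ls
     + beta * dot (residual t) (A *m dx t)).
Proof.
move=> Tt; have dr := is_derive_residual Tt.
have dfx := is_derive_along f_diff (dxE Tt).
have drl := is_derive_dot dr (is_derive_cst ls t 1).
have drr := is_deriveM_pt (is_derive_cst (beta / 2) t 1) (is_derive_dot_sqr dr).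
have dfs := is_deriveB_pt dfx (is_derive_cst (f xs) t 1).
apply: is_derive_eq (is_deriveD_pt (is_deriveD_pt dfs drl) drr) _.
by rewrite (dotC (residual t) 0) dot0l /cst; field.
Qed.

(** Differentiating the extrapolated point turns the second-order equation
    into a first-order one: the damping alpha / t combines with [theta] into
    the coefficient [xi]. *)
Lemma v_derivative t : T <= t -> is_derive t 1 v
  (- (xi *: dx t) - (theta * t) *: (grad f (x t)
     + A^T *m (w t + ls) + beta *: (A^T *m residual t))).
Proof.
move=> Tt; have t_neq0 : t != 0 by rewrite gt_eqF// pos.
have dv := is_deriveD_cV (is_deriveB_cst xs (dxE Tt))
  (is_deriveZ_cV (is_derive_scale theta t) (ddxE Tt)).
apply: is_derive_eq dv _.
have -> : w t + ls = lambda t + (theta * t) *: dlambda t.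
  by rewrite /w addrAC subrK.
have := primal_eq Tt; move=> /(congr1 (fun z => ddx t - z)).
rewrite subr0 => <-; rewrite -/(residual t).
set g := grad f (x t); set a := A^T *m _; set c := A^T *m _.
by apply/colP => i; rewrite !mxE /xi; field.
Qed.

Lemma w_derivative t : T <= t -> is_derive t 1 w
  (- (xi *: dlambda t) + (theta * t) *: (A *m v t)).
Proof.
move=> Tt; have t_neq0 : t != 0 by rewrite gt_eqF// pos.
have dw := is_deriveD_cV (is_deriveB_cst ls (dlambdaE Tt))
  (is_deriveZ_cV (is_derive_scale theta t) (ddlambdaE Tt)).
apply: is_derive_eq dw _.
have -> : A *m v t = A *m (x t + (theta * t) *: dx t) - b.
  have [/= <- _] := xls_solution.
  by rewrite -mulmxBr /v addrAC.
have := dual_eq Tt; move=> /(congr1 (fun z => ddlambda t - z)).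
rewrite subr0 => <-; set a := A *m _.
by apply/colP => i; rewrite !mxE /xi; field.
Qed.

(** The gap is weighted by (theta t)^2 so that the force along [dx t] in
    dot v v' cancels its derivative, and the anchor term is weighted by [xi] so
    that it cancels - xi dot (x t - xs) (dx t); only the force along x t - xs
    and the growth of the weight remain. *)
Lemma is_derive_energy t : T <= t -> is_derive t 1 energy
  (2 * theta ^+ 2 * t * lagrangian_gap t
   - xi * theta * t * (dot (dx t) (dx t) + dot (dlambda t) (dlambda t))
   - theta * t * (dot (x t - xs) (grad f (x t)) + dot (residual t) ls
                  + beta * dot (residual t) (residual t))).
Proof.
move=> Tt.
have dth := is_derive_scale theta t.
have dscaled := is_deriveM_pt (is_deriveM_pt dth dth) (is_derive_gap Tt).
have dvv := is_derive_dot_sqr (v_derivative Tt).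
have dww := is_derive_dot_sqr (w_derivative Tt).
have dhalf := is_deriveM_pt (is_deriveD_pt dvv dww) (is_derive_cst (2^-1 : R) t 1).
have dxx := is_derive_dot_sqr (is_deriveB_cst xs (dxE Tt)).
have dll := is_derive_dot_sqr (is_deriveB_cst ls (dlambdaE Tt)).
have danchor := is_deriveM_pt (is_derive_cst (xi / 2) t 1) (is_deriveD_pt dxx dll).
apply: is_derive_eq (is_deriveD_pt (is_deriveD_pt dscaled dhalf) danchor) _.
rewrite /cst /= dot_primal_force dot_dual_force.
have -> : A *m v t = residual t + (theta * t) *: (A *m dx t).
  by rewrite residualE mulmxDr -scalemxAr.
rewrite (dotC (grad f (x t))) (dotC (residual t) (A *m dx t)).
have dot_v d : dot (v t) d = dot (x t - xs) d + theta * t * dot (dx t) d.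
  by rewrite -dotZl -dotDl.
have dot_w : dot (w t) (dlambda t)
    = dot (lambda t - ls) (dlambda t) + theta * t * dot (dlambda t) (dlambda t).
  by rewrite -dotZl -dotDl.
rewrite !(dotDl (residual t)) !dotZl !dot_v dot_w; by field.
Qed.

Lemma energy_nonincreasing s t : T <= s -> s <= t -> energy t <= energy s.
Proof.
apply: (nonincreasing_after is_derive_energy) => {s t} t Tt.
have t_gt0 := pos Tt.
have gap_ge0 := lagrangian_gap_ge0 t.
have rr_ge0 := dot_ge0 (residual t).
(* The gradient inequality for the augmented Lagrangian at [x t]. *)
have conv : lagrangian_gap t <= dot (x t - xs) (grad f (x t))
    + dot (residual t) ls + beta * dot (residual t) (residual t).
  have := convex_grad_le f_diff (x t) xs f_convex.
  rewrite -opprB dotNr dotC /lagrangian_gap => fx_le.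
  have : 0 <= beta * dot (residual t) (residual t) by rewrite mulr_ge0.
  lra.
(* Since 2 theta <= 1, the growth of the weight is paid by that inequality. *)
have th_le : 2 * theta ^+ 2 * t * lagrangian_gap t <= theta * t * lagrangian_gap t.
  apply: ler_wpM2r => //; rewrite ler_pM2r//.
  by have := ler_wpM2l (ltW theta_gt0) theta_ub; rewrite expr2; lra.
have th_conv := ler_wpM2l (ltW (mulr_gt0 theta_gt0 t_gt0)) conv.
have : 0 <= xi * theta * t * (dot (dx t) (dx t) + dot (dlambda t) (dlambda t)).
  apply: mulr_ge0; last by apply: addr_ge0; exact: dot_ge0.
  by apply: mulr_ge0 (ltW t_gt0); apply: mulr_ge0 (ltW theta_gt0).
lra.
Qed.

Let scaled_gap_ge0 t : 0 <= theta * t * (theta * t) * lagrangian_gap t.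
Proof. by rewrite mulr_ge0 ?lagrangian_gap_ge0// -expr2 sqr_ge0. Qed.

Let anchor_ge0 t : 0 <= xi / 2 *
  (dot (x t - xs) (x t - xs) + dot (lambda t - ls) (lambda t - ls)).
Proof. by rewrite mulr_ge0 ?divr_ge0// addr_ge0 ?dot_ge0. Qed.

Lemma energy_ge0 t : 0 <= energy t.
Proof. by rewrite /energy !addr_ge0 ?divr_ge0 ?addr_ge0 ?dot_ge0. Qed.

Lemma energy_cvg : exists e : R, energy t @[t --> +oo] --> e.
Proof.
apply: (@nonincreasing_after_cvg _ energy T 0); first exact: energy_nonincreasing.
by move=> t _; exact: energy_ge0.
Qed.

Lemma scaled_gap_le t : T <= t ->
  theta * t * (theta * t) * lagrangian_gap t <= energy T.
Proof.
move=> Tt; apply: le_trans (energy_nonincreasing (lexx T) Tt).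
by rewrite /energy -addrA lerDl addr_ge0// divr_ge0// addr_ge0 ?dot_ge0.
Qed.

(** The squares of the coordinates are at most 2 * energy T; the bound
    `|a| <= a^2 + 1 avoids a square root. *)
Lemma extrapolation_bounded t : T <= t ->
  (forall i, `|v t i 0| <= 2 * energy T + 1) /\
  (forall i, `|w t i 0| <= 2 * energy T + 1).
Proof.
move=> Tt.
have norm_le (a c : R) : a ^+ 2 <= c -> `|a| <= c + 1.
  move=> ac; rewrite ler_norml; apply/andP; split; nra.
have := energy_nonincreasing (lexx T) Tt.
rewrite {1}/energy => E_le.
have := scaled_gap_ge0 t; have := anchor_ge0 t => ? ?.
have vv_ge0 := dot_ge0 (v t); have ww_ge0 := dot_ge0 (w t).
split=> i; apply: norm_le.
  by apply: le_trans (sqr_coord_le_dot (v t) i) _; lra.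
by apply: le_trans (sqr_coord_le_dot (w t) i) _; lra.
Qed.

Lemma primal_bounded i : exists D, forall t, T <= t ->
  `|x t i 0 - xs i 0| <= D /\ `|t * dx t i 0| <= D.
Proof.
apply: (@averaging_bounded _ (fun t => x t i 0 - xs i 0) (fun t => dx t i 0) theta T
  (2 * energy T + 1)) => // t Tt.
  have := is_derive_coord i (is_deriveB_cst xs (dxE Tt)).
  by under eq_fun do rewrite !mxE.
by have [+ _] := extrapolation_bounded Tt => /(_ i); rewrite !mxE.
Qed.

Lemma dual_bounded i : exists D, forall t, T <= t ->
  `|lambda t i 0 - ls i 0| <= D /\ `|t * dlambda t i 0| <= D.
Proof.
apply: (@averaging_bounded _ (fun t => lambda t i 0 - ls i 0)
  (fun t => dlambda t i 0) theta T (2 * energy T + 1)) => // t Tt.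
  have := is_derive_coord i (is_deriveB_cst ls (dlambdaE Tt)).
  by under eq_fun do rewrite !mxE.
by have [_] := extrapolation_bounded Tt => /(_ i); rewrite !mxE.
Qed.

Let velocity_div_cvg0 (y : R -> R) : (exists D, forall t, T <= t -> `|t * y t| <= D) ->
  y t / t @[t --> +oo] --> (0 : R).
Proof.
move=> [D yD]; apply: (@bounded_div_cvg0 _ _ T (D / T)) => t Tt.
have := yD t Tt; rewrite normrM (gtr0_norm (pos Tt)) => /(le_trans _) tyD.
by rewrite ler_pdivlMr// mulrC tyD// ler_wpM2r.
Qed.

Lemma dx_div_cvg0 i : dx t i 0 / t @[t --> +oo] --> (0 : R).
Proof.
apply: velocity_div_cvg0; have [D bnd] := primal_bounded i.
by exists D => t /bnd[].
Qed.

Lemma dlambda_div_cvg0 i : dlambda t i 0 / t @[t --> +oo] --> (0 : R).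
Proof.
apply: velocity_div_cvg0; have [D bnd] := dual_bounded i.
by exists D => t /bnd[].
Qed.

(** In the dual equation the residual appears as residual + theta t residual',
    equal to the derivative of dlambda plus the vanishing alpha / t * dlambda. *)
Lemma residual_cvg0 : residual t @[t --> +oo] --> (0 : 'cV[R]_m).
Proof.
apply: cvg_cV => i; rewrite mxE.
apply: (@averaging_cvg0_deriv _ (fun t => residual t i 0) (fun t => (A *m dx t) i 0)
   (fun t => dlambda t i 0) (fun t => ddlambda t i 0)
   (fun t => alpha * (dlambda t i 0 / t)) theta T) => //.
- by move=> t /is_derive_residual; exact: is_derive_coord.
- by move=> t /ddlambdaE; exact: is_derive_coord.
- move=> t Tt.
  have /(congr1 (fun z : 'cV[R]_m => z i 0)) := dual_eq Tt.
  by rewrite mulmxDr -scalemxAr /residual !mxE => dual_i; lra.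
- by have := cvgMl_tmp (a := alpha) (dlambda_div_cvg0 i); rewrite mulr0; apply.
- exact: dlambda_div_cvg0.
Qed.

(** The energy bounds t^2 times the gap. *)
Lemma gap_cvg0 : lagrangian_gap t @[t --> +oo] --> (0 : R).
Proof.
have : t * lagrangian_gap t / t @[t --> +oo] --> (0 : R).
  apply: (@bounded_div_cvg0 _ _ T (energy T / (theta ^+ 2 * T))) => t Tt.
  have t_gt0 := pos Tt; have gap_ge0 := lagrangian_gap_ge0 t.
  rewrite ger0_norm ?mulr_ge0 ?(ltW t_gt0)// ler_pdivlMr ?mulr_gt0 ?exprn_gt0//.
  apply: le_trans (scaled_gap_le Tt).
  have -> : theta * t * (theta * t) * lagrangian_gap t
    = t * lagrangian_gap t * (theta ^+ 2 * t) by ring.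
  by rewrite ler_wpM2l ?mulr_ge0 ?(ltW t_gt0)// ler_wpM2l ?exprn_ge0// ltW.
apply: cvg_trans; apply: near_eq_cvg; near=> t.
by rewrite [t * _]mulrC mulfK// gt_eqF// pos.
Unshelve. all: by end_near. Qed.

Lemma objective_cvg : f (x t) @[t --> +oo] --> f xs.
Proof.
have rl : dot (residual t) ls @[t --> +oo] --> dot 0 ls.
  exact: (@cvg_dot _ _ _ _ _ residual (fun=> ls) _ _ residual_cvg0 (cvg_cst ls)).
have rr : beta / 2 * dot (residual t) (residual t) @[t --> +oo]
    --> beta / 2 * dot (0 : 'cV[R]_m) 0.
  apply: cvgM; first exact: cvg_cst.
  exact: (@cvg_dot _ _ _ _ _ residual residual _ _ residual_cvg0 residual_cvg0).
have : lagrangian_gap t - dot (residual t) ls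
    - beta / 2 * dot (residual t) (residual t) + f xs @[t --> +oo]
    --> 0 - dot 0 ls - beta / 2 * dot (0 : 'cV[R]_m) 0 + f xs.
  by apply: cvgD; [apply: cvgB rr; apply: cvgB gap_cvg0 rl | exact: cvg_cst].
rewrite !dot0l mulr0 !subr0 add0r; apply: cvg_trans; apply: near_eq_cvg.
by near=> t; rewrite /lagrangian_gap; ring.
Unshelve. all: by end_near. Qed.

Lemma primal_cluster_solution p :
  cluster (x t @[t --> +oo]) p -> primal_dual_solutions f A b (p, ls).
Proof.
move=> xp; apply: (saddle_value_optimal f_diff f_convex xls_solution).
- apply/eqP; rewrite -subr_eq0; apply/eqP.
  have res_cont : {for p, continuous (fun z : 'cV[R]_n => A *m z - b)}.
    have Az := @cvg_mulmx _ _ _ _ (nbhs p) (nbhs_filter p) A id p cvg_id.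
    exact: (cvgB Az (cvg_cst b)).
  exact: (cluster_limit xp res_cont residual_cvg0).
- apply: (cluster_limit xp _ objective_cvg).
  exact: differentiable_continuous.
Qed.

End Energy.

(** ** Convergence of the primal and dual components *)

(** With a common multiplier [l] the dual terms are identical and the two gaps
    differ by a constant, so only the motion along p - q is left. *)
Lemma energy_difference p q l t :
  energy q l t - energy p l t
  = theta * t * (theta * t) * (f p - f q)
    + ((1 + xi) * dot (x t) (p - q) + theta * t * dot (dx t) (p - q))
    + (1 + xi) / 2 * (dot q q - dot p p).
Proof.
have /eqP := dot_shift_difference (x t) ((theta * t) *: dx t) p q.
have /eqP := dot_shift_difference (x t) 0 p q.
rewrite !addr0 (dotDl (x t) (_ *: _)) dotZl !subr_eq => /eqP xE /eqP vE.
by rewrite /energy xE vE /lagrangian_gap; field.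
Qed.

(** For cluster points p and q, [energy_difference] is up to constants
    1 + xi times the average dot (x t) (p - q) + k t dot (dx t) (p - q) with
    k = theta / (1 + xi). *)
Lemma primal_cvg xs ls : primal_dual_solutions f A b (xs, ls) ->
  exists p : 'cV[R]_n, x t @[t --> +oo] --> p.
Proof.
move=> sol; apply: (@cvg_of_clusters _ _ x T) => [i|p q xp xq].
  have [D bnd] := primal_bounded sol i; exists (D + `|xs i 0|) => t /bnd[xD _].
  by rewrite -[x t i 0](subrK (xs i 0)) (le_trans (ler_normD _ _))// lerD2r.
have p_sol := primal_cluster_solution sol xp.
have q_sol := primal_cluster_solution sol xq.
have fpq : f p - f q = 0.
  have fcont z : {for z, continuous f} by exact: differentiable_continuous.
  rewrite (cluster_limit xp (fcont p) (objective_cvg sol)).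
  by rewrite (cluster_limit xq (fcont q) (objective_cvg sol)) subrr.
have [ep Ep] := energy_cvg p_sol; have [eq Eq] := energy_cvg q_sol.
have xi1_gt0 : 0 < 1 + xi by rewrite ltr_wpDr.
pose c := (1 + xi) / 2 * (dot q q - dot p p).
exists ((1 + xi)^-1 * (eq - ep - c)).
apply: (@averaging_cvg _ (fun t => dot (x t) (p - q)) (fun t => dot (dx t) (p - q))
  ((1 + xi)^-1 * theta) T) => //.
- by rewrite mulr_gt0 ?invr_gt0.
- move=> t Tt; have := is_derive_dot (dxE Tt) (is_derive_cst (p - q) t 1).
  by rewrite (dotC (x t) 0) dot0l addr0.
have : (1 + xi)^-1 * (energy q ls t - energy p ls t - c) @[t --> +oo]
    --> (1 + xi)^-1 * (eq - ep - c).
  apply: cvgM; first exact: cvg_cst.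
  by apply: cvgB; [exact: cvgB | exact: cvg_cst].
apply: cvg_trans; apply: near_eq_cvg; near=> t.
rewrite energy_difference fpq mulr0 add0r -/c addrK.
by field; rewrite gt_eqF.
Unshelve. all: by end_near. Qed.

(** By the primal equation y = A^T (lambda - ls) satisfies
    y + theta t y' = e - x'' with [e] below (its i-th coordinate) tending to 0, since
    A^T ls = - grad f p. *)
Lemma adjoint_multiplier_cvg0 p ls : primal_dual_solutions f A b (p, ls) ->
  x t @[t --> +oo] --> p ->
  A^T *m (lambda t - ls) @[t --> +oo] --> (0 : 'cV[R]_n).
Proof.
move=> sol xp; apply: cvg_cV => i; rewrite mxE.
pose e t := - alpha * (dx t i 0 / t) - (grad f (x t) i 0 - grad f p i 0)
  - beta * (A^T *m residual t) i 0.
apply: (@averaging_cvg0_deriv _ _ (fun t => (A^T *m dlambda t) i 0)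
   (fun t => - dx t i 0) (fun t => - ddx t i 0) e theta T) => //.
- move=> t Tt; apply: is_derive_coord; apply: is_derive_mulmx.
  by apply: is_deriveB_cst; exact: dlambdaE.
- by move=> t Tt; apply: is_deriveN; apply: is_derive_coord; exact: ddxE.
- move=> t Tt; have [/= _ /(congr1 (fun z : 'cV[R]_n => z i 0))] := sol.
  have /(congr1 (fun z : 'cV[R]_n => z i 0)) := primal_eq Tt.
  rewrite /e -/(residual t) (mulmxBr A^T (lambda t)) mulmxDr -scalemxAr.
  move: (A^T *m ls) (A^T *m lambda t) (A^T *m dlambda t) (A^T *m residual t).
  move: (grad f p) (grad f (x t)) => g0 g l0 l1 l2 r.
  by rewrite !mxE; lra.
- have dx0 := dx_div_cvg0 sol i.
  have grad_cvg : grad f (x t) i 0 @[t --> +oo] --> grad f p i 0.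
    by apply: cvg_coord; apply: (cvg_comp _ _ xp); exact: grad_continuous.
  have res0 : (A^T *m residual t) i 0 @[t --> +oo] --> (A^T *m 0 : 'cV[R]_n) i 0.
    by apply: cvg_coord; apply: cvg_mulmx; exact: residual_cvg0 sol.
  rewrite mulmx0 mxE in res0.
  rewrite [X in _ --> X](_ : 0 = - alpha * 0 - (grad f p i 0 - grad f p i 0)
    - beta * 0); last by ring.
  apply: cvgB; last by apply: cvgM => //; exact: cvg_cst.
  apply: cvgB; first by apply: cvgM => //; exact: cvg_cst.
  by apply: cvgB => //; exact: cvg_cst.
- have -> : (fun t => - dx t i 0 / t) = (fun t => - (dx t i 0 / t)).
    by apply/funext => t; rewrite mulNr.
  have := cvgN (dx_div_cvg0 sol i); rewrite oppr0; exact.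
Qed.

(** The forcing term of the dual equation lies in the range of [A], since
    b = A p, and so is orthogonal to [d]. *)
Lemma dual_kernel_component_cvg p ls d : primal_dual_solutions f A b (p, ls) ->
  A^T *m d = 0 -> exists l : R, dot (lambda t) d @[t --> +oo] --> l.
Proof.
move=> sol Ad0; have [/= Apb _] := sol.
have orth y : dot (A *m y) d = 0 by rewrite -dot_mulmx Ad0 dotC dot0l.
pose h t := dot (lambda t) d * (alpha - 1) + t * dot (dlambda t) d.
have dlE t : T <= t -> is_derive t 1 (fun s => dot (lambda s) d) (dot (dlambda t) d).
  move=> Tt; have := is_derive_dot (dlambdaE Tt) (is_derive_cst d t 1).
  by rewrite (dotC _ 0) dot0l addr0.
have ddlE t : T <= t -> is_derive t 1 (fun s => dot (dlambda s) d) (dot (ddlambda t) d).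
  move=> Tt; have := is_derive_dot (ddlambdaE Tt) (is_derive_cst d t 1).
  by rewrite (dotC _ 0) dot0l addr0.
(* First integral of s'' + (alpha / t) s' = 0. *)
have h_const : forall t, T <= t -> h t = h T.
  apply: constant_after => t Tt; have t_neq0 : t != 0 by rewrite gt_eqF// pos.
  have dh := is_deriveD_pt (is_deriveM_pt (dlE t Tt) (is_derive_cst (alpha - 1) t 1))
    (is_deriveM_pt (is_derive_id t (1 : R)) (ddlE t Tt)).
  apply: is_derive_eq dh _; rewrite /cst /=.
  have /(congr1 (fun z => dot z d)) := dual_eq Tt.
  rewrite -Apb -mulmxBr dot0l dotDl dotNl orth subr0 dotDl dotZl.
  move=> /eqP; rewrite addr_eq0 => /eqP ->.
  by field.
have alpha1_gt0 : 0 < alpha - 1 by rewrite subr_gt0.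
exists ((alpha - 1)^-1 * h T).
apply: (@averaging_cvg _ _ (fun t => dot (dlambda t) d) (alpha - 1)^-1 T) => //.
  by rewrite invr_gt0.
have h_cvg : (alpha - 1)^-1 * h T @[_ --> (+oo : set_system R)] --> (alpha - 1)^-1 * h T.
  exact: cvg_cst.
apply: cvg_trans h_cvg; apply: near_eq_cvg; near=> t.
rewrite -(h_const t)// /h; field.
by rewrite gt_eqF.
Unshelve. all: by end_near. Qed.

Lemma dual_cvg p ls : primal_dual_solutions f A b (p, ls) ->
  x t @[t --> +oo] --> p ->
  exists2 l : 'cV[R]_m, lambda t @[t --> +oo] --> l & A^T *m l = A^T *m ls.
Proof.
move=> sol xp; have adj0 := adjoint_multiplier_cvg0 sol xp.
have adj_cluster l : cluster (lambda t @[t --> +oo]) l -> A^T *m (l - ls) = 0.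
  move=> ll; apply: (cluster_limit (g := fun z => A^T *m (z - ls)) ll _ adj0).
  apply: (@cvg_mulmx _ _ _ _ (nbhs l) (nbhs_filter l) A^T (fun z => z - ls)).
  exact: (cvgB cvg_id (cvg_cst ls)).
have [i|l1 l2 /adj_cluster Al1 /adj_cluster Al2|l ll] := @cvg_of_clusters _ _ lambda T.
- have [D bnd] := dual_bounded sol i; exists (D + `|ls i 0|) => t /bnd[lD _].
  by rewrite -[lambda t i 0](subrK (ls i 0)) (le_trans (ler_normD _ _))// lerD2r.
- apply: (dual_kernel_component_cvg sol).
  have -> : l1 - l2 = (l1 - ls) - (l2 - ls) by rewrite opprB addrA subrK.
  by rewrite mulmxBr Al1 Al2 subrr.
exists l => //; apply/eqP; rewrite -subr_eq0 -mulmxBr; apply/eqP.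
by apply: adj_cluster; exact: cvg_cluster_pinfty.
Qed.

Lemma trajectory_cvg xs ls : primal_dual_solutions f A b (xs, ls) ->
  exists2 z : 'cV[R]_n * 'cV[R]_m,
    primal_dual_solutions f A b z & (x t, lambda t) @[t --> +oo] --> z.
Proof.
move=> sol; have [p xp] := primal_cvg sol.
have p_sol : primal_dual_solutions f A b (p, ls).
  by apply: primal_cluster_solution sol _ _; exact: cvg_cluster_pinfty.
have [l ll Al] := dual_cvg p_sol xp.
exists (p, l); last exact: (cvg_pair xp ll).
by have [/= Apb gradp] := p_sol; split=> //=; rewrite Al.
Qed.

End Trajectory.

Theorem theorem2p2 (R : realType) (n m : nat) (f : 'cV[R]_n -> R)
    (A : 'M[R]_(m, n)) (b : 'cV[R]_m) (alpha theta beta t0 : R)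
    (x : R -> 'cV[R]_n) (lambda : R -> 'cV[R]_m)
    (f_convex : convex_function [set: 'cV[R]_n] f)
    (f_C1 : continuously_differentiable f)
    (S_nonempty : primal_solutions f A b !=set0)
    (t0_gt0 : 0 < t0)
    (alpha_ge3 : 3 <= alpha)
    (theta_bounds : 1 / (alpha - 1) <= theta <= 1 / 2)
    (beta_ge0 : 0 <= beta)
    (x_lambda_trajectory : is_trajectory f A b alpha theta beta t0 x lambda) :
  exists2 z : 'cV[R]_n * 'cV[R]_m,
    primal_dual_solutions f A b z &
    (x t, lambda t) @[t --> +oo] --> z.
Proof.
have [f_diff grad_cont] := f_C1.
have [xs /(multiplier_exists f_diff)[ls sol]] := S_nonempty.
have [dx [ddx [dlambda [ddlambda ode]]]] := x_lambda_trajectory.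
have /andP[theta_lb theta_ub] := theta_bounds.
have alpha_gt1 : 1 < alpha by lra.
(* Starting at [t0 + 1] leaves room on both sides, so that the one-sided
     derivatives become ordinary ones. *)
have t0_lt t : t0 + 1 <= t -> t0 < t by lra.
apply: (@trajectory_cvg R n m f A b alpha theta beta (t0 + 1)
  x dx ddx lambda dlambda ddlambda _ _ _ _ _ _ _ _ _ _ _ _ _ _ xs ls) => //.
- by rewrite addr_gt0.
- by rewrite -ler_pdivrMr// subr_gt0.
- by move=> t /t0_lt t0t; have [[/(is_derive_within t0t)]] := ode t (ltW t0t).
- by move=> t /t0_lt t0t; have [[_ /(is_derive_within t0t)]] := ode t (ltW t0t).
- by move=> t /t0_lt t0t; have [_ [/(is_derive_within t0t)]] := ode t (ltW t0t).
- by move=> t /t0_lt t0t; have [_ [_ /(is_derive_within t0t)]] := ode t (ltW t0t).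
- by move=> t /t0_lt t0t; have [] := ode t (ltW t0t).
- by move=> t /t0_lt t0t; have [] := ode t (ltW t0t).
Qed.
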